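(* Let $D$ and $H$ be digraphs, and for each $u\in V(D)$ and $i\in V(H)$ let a positive cost $c_i(u)$ be given. Let $\mu=\max\{c_j(v):\ v\in V(D),\ j\in V(H)\}$, and let $D\otimes H$ be the homomorphic product of $D$ and $H$, with vertex weights $c(u_i)=c_i(u)+\mu|V(D)|$. Then there is a homomorphism of $D$ to $H$ if and only if the number of vertices in a largest independent set of $D\otimes H$ equals $|V(D)|$. Moreover, if $HOM(D,H)\neq\emptyset$, then a homomorphism $h\in HOM(D,H)$ is of maximum cost if and only if $I=\{x_{h(x)}:\ x\in V(D)\}$ is an independent set of $D\otimes H$ of maximum cost, where the cost of a set $X\subseteq V(D\otimes H)$ is $c(X)=\sum_{x\in X}c(x)$.
   Context: Digraphs have no loops and no parallel arcs (pairs of opposite arcs are allowed). For digraphs $D,H$, a map $f:V(D)\to V(H)$ is a homomorphism of $D$ to $H$ if $uv\in A(D)$ implies $f(u)f(v)\in A(H)$; $HOM(D,H)$ denotes the set of all homomorphisms of $D$ to $H$. The cost of a homomorphism $f$ is $\sum_{u\in V(D)}c_{f(u)}(u)$. The homomorphic product $D\otimes H$ is the undirected graph with vertex set $\{u_i:\ u\in V(D),\ i\in V(H)\}$ and edge set $\{u_iv_j:\ uv\in A(D),\ ij\notin A(H)\}\cup\{u_iu_j:\ u\in V(D),\ i\neq j\in V(H)\}$. *)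

(* Defs.v *)
From mathcomp Require Import all_boot all_order all_algebra.

Set Implicit Arguments.
Unset Strict Implicit.
Unset Printing Implicit Defensive.

Import Order.TTheory GRing.Theory Num.Theory.
Local Open Scope ring_scope.

(* Parallel arcs are impossible because arcs form a relation; opposite arcs
   are allowed because no antisymmetry is required. *)
Record digraph := Digraph {
  vertex :> finType;
  arc : rel vertex;
  arc_irreflexive : irreflexive arc
}.

Record sgraph := SGraph {
  svertex :> finType;
  edge : rel svertex;
  edge_symmetric : symmetric edge;
  edge_irreflexive : irreflexive edge
}.

Definition independent (G : sgraph) (S : {set G}) : bool :=
  [forall x in S, forall y in S, ~~ edge x y].

Definition independence_number (G : sgraph) : nat :=
  (\max_(S : {set G} | independent S) #|S|)%N.

Definition set_cost (R : realDomainType) (G : sgraph) (w : G -> R)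
    (S : {set G}) : R :=
  \sum_(x in S) w x.

Definition max_cost_independent (R : realDomainType) (G : sgraph)
    (w : G -> R) (S : {set G}) : Prop :=
  independent S /\
  forall T : {set G}, independent T -> set_cost w T <= set_cost w S.

Section Homomorphisms.

Variables D H : digraph.

Definition HOM : {set {ffun D -> H}} :=
  [set f : {ffun D -> H} | [forall u, forall v, arc u v ==> arc (f u) (f v)]].

(* The pair (u, i) is the vertex u_i.  Edges are unordered, so the
   condition "uv is an arc of D and ij is not an arc of H" is taken in both
   orientations (the first two disjuncts). *)
Definition homprod_edge (x y : D * H) : bool :=
  [|| arc x.1 y.1 && ~~ arc x.2 y.2,
      arc y.1 x.1 && ~~ arc y.2 x.2
    | (x.1 == y.1) && (x.2 != y.2)].

Lemma homprod_edge_symmetric : symmetric homprod_edge.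
Proof.
move=> x y; rewrite /homprod_edge orbCA.
by rewrite (eq_sym x.1) (eq_sym x.2).
Qed.

Lemma homprod_edge_irreflexive : irreflexive homprod_edge.
Proof. by move=> x; rewrite /homprod_edge !arc_irreflexive !eqxx. Qed.

Definition homprod : sgraph :=
  SGraph homprod_edge_symmetric homprod_edge_irreflexive.

Definition graph_of (f : {ffun D -> H}) : {set homprod} :=
  [set ((x, f x) : homprod) | x : D].

Variables (R : realDomainType) (c : H -> D -> R).

Definition hom_cost (f : {ffun D -> H}) : R := \sum_(u : D) c (f u) u.

Definition max_cost_hom (h : {ffun D -> H}) : Prop :=
  h \in HOM /\ forall f, f \in HOM -> hom_cost f <= hom_cost h.

(* The default value 0 only matters when D or H has no vertex, since the
   costs are assumed positive; D (x) H has then no vertex either. *)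
Definition max_cost : R := \big[Num.max/0]_(v : D) \big[Num.max/0]_(j : H) c j v.

Definition homprod_weight (x : homprod) : R :=
  c x.2 x.1 + max_cost * #|D|%:R.

End Homomorphisms.

(* Main.v *)
Require Import Defs.
From mathcomp Require Import all_boot all_order all_algebra.

Set Implicit Arguments.
Unset Strict Implicit.
Unset Printing Implicit Defensive.

Import Order.TTheory GRing.Theory Num.Theory.
Local Open Scope ring_scope.

(* The edges [u_i u_j] force an independent set of the product to meet each
   fibre over [D] at most once, so the independent sets of cardinality [#|D|]
   are exactly the graphs of homomorphisms, and the graph of [f] costs
   [hom_cost c f + mu * #|D| ^ 2].  A smaller independent set costs at most
   [(#|D| - 1) * (mu + mu * #|D|) = mu * (#|D| ^ 2 - 1)], hence never more than
   the graph of a homomorphism. *)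

Section HomomorphicProduct.

Variables D H : digraph.
Implicit Types (f : {ffun D -> H}) (S : {set homprod D H}).

Lemma independent_fst_inj S : independent S -> {in S &, injective fst}.
Proof.
move=> /forall_inP indS [u i] [v j] Sx Sy /= uv; subst v.
have /forall_inP/(_ _ Sy) := indS _ Sx.
by rewrite /= /homprod_edge /= !arc_irreflexive eqxx /= negbK => /eqP->.
Qed.

Lemma leq_card_independent S : independent S -> (#|S| <= #|D|)%N.
Proof. by move=> /independent_fst_inj/card_in_imset <-; apply: max_card. Qed.

Lemma mem_graph_of f (x : homprod D H) : (x \in graph_of f) = (f x.1 == x.2).
Proof.
case: x => u i /=; apply/imsetP/eqP => [[v _ [-> ->]] // | <-].
by exists u.
Qed.

Lemma card_graph_of f : #|graph_of f| = #|D|.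
Proof. by rewrite card_imset // => u v []. Qed.

(** Two vertices of a graph never share a fibre, so they can be adjacent only through an arc of [D]
    whose image under [f] is not an arc of [H]. *)
Lemma independent_graph_of f : independent (graph_of f) = (f \in HOM D H).
Proof.
rewrite inE; apply/idP/idP => [/forall_inP ind | /forallP homf].
- apply/forallP => u; apply/forallP => v; apply/implyP => uv.
  have gf w : ((w, f w) : homprod D H) \in graph_of f by rewrite mem_graph_of.
  have /forall_inP/(_ _ (gf v)) := ind _ (gf u).
  by rewrite /= /homprod_edge /= uv /= !negb_or negbK => /andP[].
- apply/forall_inP => -[u i]; rewrite mem_graph_of /= => /eqP <-.
  apply/forall_inP => -[v j]; rewrite mem_graph_of /= => /eqP <-.
  have arcF a b : Defs.arc a b && ~~ Defs.arc (f a) (f b) = false.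
    by apply/negbTE; rewrite negb_and negbK -implybE; exact: (forallP (homf a)).
  by rewrite /homprod_edge /= !arcF /=; case: eqP => //= ->; rewrite eqxx.
Qed.

(** By cardinality the injective first projection is onto [D], so [S] contains a point over each
    [u]; choosing one gives a graph inside [S] of the same size. *)
Lemma independent_full_graph S : independent S -> #|S| = #|D| ->
  exists2 f, f \in HOM D H & S = graph_of f.
Proof.
move=> indS cardS.
have fstS : [set x.1 | x in S] = [set: D].
  apply/eqP; rewrite eqEcard subsetT cardsT -cardS /=.
  by rewrite (card_in_imset (independent_fst_inj indS)).
have /fin_all_exists[g Sg] u : exists i, ((u, i) : homprod D H) \in S.
  by have /imsetP[[v i] Sx ->] : u \in [set x.1 | x in S]; [rewrite fstS | exists i].
have SE : S = graph_of (finfun g).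
  apply/esym/eqP; rewrite eqEcard card_graph_of cardS leqnn andbT.
  by apply/subsetP => -[u i]; rewrite mem_graph_of /= ffunE => /eqP <-.
by exists (finfun g); rewrite // -independent_graph_of -SE.
Qed.

Lemma independence_number_homprod :
  (exists f, f \in HOM D H) <-> independence_number (homprod D H) = #|D|.
Proof.
split=> [[f homf] | alphaE].
- apply/eqP; rewrite eqn_leq; apply/andP; split.
    by apply/bigmax_leqP => S; apply: leq_card_independent.
  rewrite -(card_graph_of f); apply: leq_bigmax_cond.
  by rewrite independent_graph_of.
(* The empty set makes the maximum range over a nonempty family, so some independent set attains
   it. *)
- have ind0 : independent (set0 : {set homprod D H}).
    by apply/forall_inP => x; rewrite inE.
  have [|S indS maxS] := @eq_bigmax_cond _ (@independent (homprod D H)) (fun S => #|S|).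
    by apply/card_gt0P; exists set0.
  have [|f homf _] := @independent_full_graph S indS; first by rewrite -maxS.
  by exists f.
Qed.

Variables (R : realDomainType) (c : H -> D -> R).

(** The default 0 of the maximum is a lower bound; [set_cost_small] uses this sign to scale an
    inequality between naturals. *)
Lemma max_cost_ge0 : 0 <= max_cost c.
Proof. exact: bigmax_ge_id. Qed.

Lemma le_max_cost (i : H) (u : D) : c i u <= max_cost c.
Proof.
apply: le_trans (le_bigmax _ (fun v => \big[Num.max/0]_(j : H) c j v) u).
exact: (le_bigmax _ (fun j => c j u)).
Qed.

Lemma set_cost_graph_of f :
  set_cost (homprod_weight c) (graph_of f) =
  hom_cost c f + max_cost c * #|D|%:R *+ #|D|.
Proof.
rewrite /set_cost big_imset /=; last by move=> u v _ _ [].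
by rewrite big_split /= sumr_const.
Qed.

Lemma set_cost_small S : (#|S| < #|D|)%N ->
  set_cost (homprod_weight c) S <= max_cost c * #|D|%:R *+ #|D|.
Proof.
move=> ltSD; have mu0 := max_cost_ge0.
have [n Dn] : exists n, #|D| = n.+1 by case: #|D| ltSD => // n; exists n.
(* Each weight is at most [max_cost c] plus the shift [max_cost c * #|D|]. *)
apply: (@le_trans _ _ (\sum_(x in S) (max_cost c * #|D|.+1%:R))).
  apply: ler_sum => x _; rewrite /homprod_weight [#|D|.+1%:R]mulrS mulrDr mulr1.
  by rewrite lerD2r le_max_cost.
rewrite sumr_const -!mulrnAr ler_wpM2l // -!mulrnA ler_nat.
(* With [#|D| = n.+1] and [#|S| <= n], it remains that [n.+2 * n <= n.+1 * n.+1]. *)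
rewrite Dn in ltSD *; apply: (@leq_trans (n.+2 * n)%N).
  by rewrite leq_mul2l -ltnS ltSD.
by rewrite mulSn mulnS leq_add2r.
Qed.

Lemma max_cost_hom_graph_of (c_ge0 : forall u i, 0 <= c i u) h : h \in HOM D H ->
  max_cost_hom c h <-> max_cost_independent (homprod_weight c) (graph_of h).
Proof.
move=> homh; split=> [[_ maxh] | [_ maxh]]; split=> //.
- by rewrite independent_graph_of.
- move=> T indT; rewrite set_cost_graph_of.
  have [ltTD | geTD] := ltnP #|T| #|D|.
    (* The bound on a small set is exactly the constant part of the cost of [graph_of h]; what
       remains is [hom_cost c h], a sum of nonnegative terms. *)
    apply: le_trans (set_cost_small ltTD) _.
    by rewrite lerDr sumr_ge0 // => u _; apply: c_ge0.
  have cardT : #|T| = #|D|.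
    by apply/eqP; rewrite eqn_leq geTD leq_card_independent.
  have [f homf ->] := independent_full_graph indT cardT.
  by rewrite set_cost_graph_of lerD2r maxh.
(* Testing against graphs of homomorphisms suffices, since the common constant cancels. *)
- move=> f homf; have := maxh (graph_of f).
  by rewrite independent_graph_of !set_cost_graph_of lerD2r; apply.
Qed.

End HomomorphicProduct.

Theorem theorem2p1 (R : realDomainType) (D H : digraph) (c : H -> D -> R)
    (c_gt0 : forall (u : D) (i : H), 0 < c i u) :
  ((exists f : {ffun D -> H}, f \in HOM D H) <->
     independence_number (homprod D H) = #|D|) /\
  (HOM D H != set0 ->
   forall h : {ffun D -> H}, h \in HOM D H ->
     (max_cost_hom c h <->
      max_cost_independent (homprod_weight c) (graph_of h))).
Proof.
split; first exact: independence_number_homprod.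
by move=> _ h; apply: max_cost_hom_graph_of => u i; apply: ltW.
Qed.
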